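(* Let $p$ be a prime. The following four statements are equivalent: (MC$\mathbf{1}$) for all finite groups $G$, $(\mathbb{C}[G], \mathbb{C}[N])$ is an M-pair; (MCD) for all finite groups $G$, $(D(G), D(N))$ is an M-pair; (MCX) for all finite groups $G$ and all finite non-empty left $G$-sets $X$, $(D_X(G), D_X(N))$ is an M-pair; (MCT) for all finite groups $G$ and all finite non-empty transitive left $G$-sets $X$, $(D_X(G), D_X(N))$ is an M-pair. Here, in each statement, $N = N_G(P)$ is the normalizer in $G$ of a Sylow $p$-subgroup $P$ of $G$.
   Context: All algebras and modules are finite-dimensional over $\mathbb{C}$. The prime $p$ is fixed. For an algebra $A$, $\mu(A)$ denotes the number of inequivalent (i.e. isomorphism classes of) simple $A$-modules of dimension coprime to $p$. A pair of algebras $(A,B)$ is an M-pair if $\mu(A)=\mu(B)$. $\mathbb{C}[G]$ is the group algebra. For a finite group $G$ and a finite non-empty left $G$-set $X$, $D_X(G)$ is the algebra with underlying space $\mathbb{C}[X]^* \otimes_{\mathbb{C}} \mathbb{C}[G]$, where $\mathbb{C}[X]^*$ is the space of complex functions on $X$ with basis the delta functions $e(x): y \mapsto \delta_{x,y}$, and with product $$(e(x)\otimes g)(e(y)\otimes h) = \delta_{x, g.y}\, e(x)\otimes gh, \quad x,y\in X,\ g,h\in G.$$ In $D_X(N)$, the $G$-set $X$ is regarded as an $N$-set by restriction of the action. The quantum double is $D(G) = D_{G_{conj}}(G)$, where $G_{conj}$ is the set $G$ with left $G$-action by conjugation $g: x\mapsto gxg^{-1}$; likewise $D(N) = D_{N_{conj}}(N)$.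 *)

(* Defs.v *)
From HB Require Import structures.
From mathcomp Require Import all_boot all_order all_algebra all_fingroup.
From mathcomp Require Import all_solvable all_field.
From mathcomp Require Import boolp classical_sets.

Set Implicit Arguments.
Unset Strict Implicit.
Unset Printing Implicit Defensive.

Import GRing.Theory.
Local Open Scope ring_scope.

Record amodule (F : fieldType) (A : falgType F) := AModule {
  msort :> vectType F;
  mact : {linear A -> 'End(msort)};
  mact1 : mact 1 = \1%VF;
  mactM : forall a b, mact (a * b) = (mact a \o mact b)%VF }.

Section Modules.
Variables (F : fieldType) (A : falgType F).
Implicit Types M N : amodule A.

Definition submodule M (U : {vspace M}) : Prop :=
  forall (a : A) (v : M), v \in U -> mact M a v \in U.

Definition simple_module M : Prop :=
  (exists v : M, v != 0) /\
  (forall U : {vspace M}, submodule U -> U = 0%VS \/ U = fullv).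

Definition module_iso M N : Prop :=
  exists f : 'Hom(M, N),
    bijective f /\ forall (a : A) (v : M), f (mact M a v) = mact N a (f v).

Variable p : nat.

Definition mu_module M : Prop := simple_module M /\ coprime p (\dim {:M}).

Definition mu_indep n (M : 'I_n -> amodule A) : Prop :=
  (forall i, mu_module (M i)) /\
  (forall i j, module_iso (M i) (M j) -> i = j).

Definition mu_spec (n : nat) : Prop :=
  exists M : 'I_n -> amodule A, mu_indep M /\
    forall S, mu_module S -> exists i, module_iso S (M i).

(* The default value 0 is never used: see muP and mu_spec_uniq. *)
Definition mu : nat := xget 0%N [set n | mu_spec n].

Lemma module_iso_sym M N : module_iso M N -> module_iso N M.
Proof.
case=> f [bf fA]; have /lker0P kf := bij_inj bf.
have [g fK gK] := bf.
have fVK v : f (f^-1%VF v) = v by rewrite -[v]gK lker0_lfunK.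
exists f^-1%VF; split=> [|a v].
  by exists f => // v; rewrite lker0_lfunK.
by apply: (bij_inj bf); rewrite fA !fVK.
Qed.

Lemma module_iso_trans M N S :
  module_iso M N -> module_iso N S -> module_iso M S.
Proof.
case=> f [bf fA] [g [bg gA]]; exists (g \o f)%VF; split=> [|a v].
  apply: (eq_bij (bij_comp bg bf)) => v; by rewrite comp_lfunE.
by rewrite !comp_lfunE fA gA.
Qed.

Lemma mu_spec_uniq m n : mu_spec m -> mu_spec n -> m = n.
Proof.
have le m' n' : mu_spec m' -> mu_spec n' -> (m' <= n')%N.
  case=> M [[sM uM] _] [N [_ cN]].
  have /boolp.choice[f fP] : forall i, exists j, module_iso (M i) (N j).
    by move=> i; exact: cN.
  suff /leq_card : injective f by rewrite !card_ord.
  move=> i j fij; apply: uM; apply: module_iso_trans (fP i) _.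
  by rewrite fij; exact: module_iso_sym.
by move=> h1 h2; apply/eqP; rewrite eqn_leq !le.
Qed.

Definition mev M (v : M) : 'Hom(A, M) := linfun (fun a : A => mact M a v).

Lemma mev_is_linear M (v : M) : linear (fun a : A => mact M a v).
Proof. by move=> c a b; rewrite linearP add_lfunE scale_lfunE. Qed.

Lemma mevE M (v : M) a : mev v a = mact M a v.
Proof.
pose l := GRing.isLinear.Build F A M _ _ (mev_is_linear v).
pose f : {linear A -> M} := HB.pack (fun a : A => mact M a v) l.
exact: (lfunE f).
Qed.

Lemma mactME M a b (v : M) : mact M (a * b) v = mact M a (mact M b v).
Proof. by rewrite mactM comp_lfunE. Qed.

Lemma simple_hom_iso M N (f : 'Hom(M, N)) :
    simple_module M -> simple_module N ->
    (forall a v, f (mact M a v) = mact N a (f v)) -> f != 0 ->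
  module_iso M N.
Proof.
move=> [_ sM] [_ sN] fA f0; exists f; split=> //.
have kf : lker f = 0%VS.
  case: (sM (lker f)) => // [a v|kT].
    by rewrite !memv_ker fA => /eqP->; rewrite linear0.
  case/eqP: f0; apply/lfunP=> v; rewrite zero_lfunE; apply/eqP.
  by rewrite -memv_ker kT memvf.
have lf : limg f = fullv.
  case: (sN (limg f)) => // [a _ /memv_imgP[v _ ->]|l0].
    by rewrite -fA memv_img ?memvf.
  case/eqP: f0; apply/lfunP=> v; rewrite zero_lfunE; apply/eqP.
  by rewrite -memv0 -l0 memv_img ?memvf.
exists (f^-1)%VF => v; first by rewrite lker0_lfunK ?kf.
by rewrite limg_lfunVK // lf memvf.
Qed.

(* Two maps out of a left ideal J with simple targets, the kernel of the first
   being contained in that of the second. *)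
Lemma ideal_iso M N (v : M) (w : N) (J : {vspace A}) :
    simple_module M -> simple_module N ->
    (forall a b, b \in J -> a * b \in J) ->
    ~~ (J <= lker (mev v))%VS -> ~~ (J <= lker (mev w))%VS ->
    (J :&: lker (mev v) <= lker (mev w))%VS ->
  module_iso M N.
Proof.
move=> sM sN Jl nJv nJw kvw.
have im : (mev v @: J)%VS = fullv.
  case: sM => _ /(_ (mev v @: J)%VS) [a _ /memv_imgP[b Jb ->]|J0|//].
    by rewrite mevE -mactME -mevE memv_img ?Jl.
  case/negP: nJv; apply/subvP=> b Jb; rewrite memv_ker -memv0 -J0.
  exact: memv_img.
pose h := (mev v \o projv J)%VF.
have limh : limg h = fullv by rewrite limg_comp limg_proj.
pose q := (projv J \o h^-1)%VF.
have qJ u : q u \in J by rewrite comp_lfunE memv_proj.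
have qK u : mev v (q u) = u.
  by rewrite [q u]comp_lfunE -[mev v _]comp_lfunE limg_lfunVK // limh memvf.
clearbody q.
have qw b : b \in J -> mev w (q (mev v b)) = mev w b.
  move=> Jb; apply/eqP; rewrite -subr_eq0 -linearB -memv_ker.
  by apply: (subvP kvw); rewrite memv_cap memvB //= memv_ker linearB /= qK subrr.
apply: (@simple_hom_iso M N (mev w \o q)%VF) => //.
  move=> a u; rewrite !comp_lfunE.
  have -> : mact M a u = mev v (a * q u) by rewrite mevE mactME -(mevE v) qK.
  by rewrite qw ?Jl // !mevE mactME.
apply: contraNneq nJw => f0; apply/subvP=> b Jb.
by rewrite memv_ker -qw // -[mev w _]comp_lfunE f0 zero_lfunE.
Qed.

Lemma mu_indep_leq n (M : 'I_n -> amodule A) : mu_indep M -> (n <= \dim {:A})%N.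
Proof.
case=> sM uM.
have ex i : exists v : M i, v != 0 by case: (sM i) => [[]].
pose v i := xchoose (ex i); have v0 i : v i != 0 by exact: (xchooseP (ex i)).
pose I i := lker (mev (v i)).
pose J k := (\bigcap_(i < n | (i < k)%N) I i)%VS.
have J0 : J 0%N = fullv by apply: big1 => i.
have JS (i : 'I_n) : J i.+1 = (J i :&: I i)%VS.
  rewrite /J (bigD1 i) //= capvC; congr (_ :&: _)%VS.
  by apply: eq_bigl => j; rewrite ltnS andbC [RHS]ltn_neqAle -val_eqE.
have Jl k a b : b \in J k -> a * b \in J k.
  rewrite !memvE => /subv_bigcapP Jb; apply/subv_bigcapP => i ik.
  have := Jb i ik; rewrite -!memvE !memv_ker !mevE mactME => /eqP->.
  by rewrite linear0.
have nJ (k : 'I_n) : ~~ (J k <= I k)%VS.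
  apply/negP=> Jk.
  have exm : exists m, (J m <= I k)%VS by exists k.
  have := ex_minnP exm; case=> [[|j]] Jm minm.
    have := subvP Jm 1; rewrite J0 memvf => /(_ isT).
    by rewrite memv_ker mevE mact1 id_lfunE (negPf (v0 k)).
  have jk : (j < k)%N by exact: minm.
  pose i : 'I_n := Ordinal (ltn_trans jk (ltn_ord k)).
  have nk : ~~ (J i <= I k)%VS by apply/negP=> /minm; rewrite ltnn.
  have ni : ~~ (J i <= I i)%VS.
    by apply: contra nk => /capv_idPl E; move: Jm; rewrite -[j]/(val i) JS E.
  have /uM ik : module_iso (M i) (M k).
    apply: (@ideal_iso _ _ (v i) (v k) (J i)) => //;
      [by case: (sM i) | by case: (sM k) | exact: Jl | by rewrite -JS].
  by have := jk; rewrite -ik ltnn.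
suff /(_ n (leqnn n)) : forall k, (k <= n)%N -> (\dim (J k) + k <= \dim {:A})%N.
  by apply: leq_trans; rewrite leq_addl.
elim=> [|k IH] kn; first by rewrite addn0 J0.
apply: leq_trans (IH (ltnW kn)); rewrite addnS ltn_add2r.
pose i := Ordinal kn; rewrite -[k]/(val i) JS.
rewrite ltnNge; apply: contra (nJ i) => le.
by apply/capv_idPl/eqP; rewrite eqEdim capvSl.
Qed.

Lemma muP : mu_spec mu.
Proof.
suff : exists n, mu_spec n by exact: (@xgetPex _ 0%N [set n | mu_spec n]).
pose P n := `[< exists M : 'I_n -> amodule A, mu_indep M >].
have P0 : exists n, P n.
  exists 0%N; apply/asboolP; exists (fun i : 'I_0 => match notF (ltn_ord i) with end).
  by split=> [[] | []].
have Pb n : P n -> (n <= \dim {:A})%N by move=> /asboolP[M /mu_indep_leq].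
case: (ex_maxnP P0 Pb) => n /asboolP[M [sM uM]] maxn.
exists n, M; split=> // S sS; apply: contrapT => nS.
suff /maxn : P n.+1 by rewrite ltnn.
apply/asboolP; exists (fun i => if unlift ord_max i is Some j then M j else S).
split=> [i|i j]; first by case: unliftP.
case: unliftP => [i' ->|->]; case: unliftP => [j' ->|->] //.
- by move=> /uM->.
- by move=> /module_iso_sym iso; case: nS; exists i'.
- by move=> iso; case: nS; exists j'.
Qed.
End Modules.

(* MathComp's own {action _ &-> _} are right actions. *)
Record lset (gT : finGroupType) := LSet {
  lset_sort :> finType;
  lact : gT -> lset_sort -> lset_sort;
  lact1 : forall x, lact 1%g x = x;
  lactM : forall g h x, lact (g * h)%g x = lact g (lact h x);
  lset_gt0 : (0 < #|lset_sort|)%N }.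

Definition ltransitive (gT : finGroupType) (X : lset gT) : Prop :=
  forall x y : X, exists g : gT, lact g x = y.

Section LeftSets.
Variables (gT : finGroupType) (N : {group gT}) (X : lset gT).

Definition lset_restr : lset (subg_of N) :=
  @LSet (subg_of N) X (fun g x => lact (sgval g) x) (@lact1 _ X)
    (fun g h x => @lactM _ X (sgval g) (sgval h) x) (lset_gt0 X).

(* g.x = g x g^-1; MathComp's x ^ y is y^-1 x y. *)
Definition lconj (g x : gT) : gT := (g * x * g^-1)%g.

Fact lconj1 x : lconj 1%g x = x.
Proof. by rewrite /lconj mul1g invg1 mulg1. Qed.

Fact lconjM g h x : lconj (g * h)%g x = lconj g (lconj h x).
Proof. by rewrite /lconj invMg !mulgA. Qed.

Fact card_group_gt0 : (0 < #|gT|)%N.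
Proof. by apply/card_gt0P; exists 1%g. Qed.

Definition lset_conj : lset gT := LSet lconj1 lconjM card_group_gt0.

End LeftSets.

Section GroupAlgebra.
Variables (F : fieldType) (gT : finGroupType).

Definition group_alg : Type := {ffun gT -> F^o}.
HB.instance Definition _ := Vector.copy group_alg {ffun gT -> F^o}.
Implicit Types a b c : group_alg.

Definition gbasis (g : gT) : group_alg := [ffun k => (k == g)%:R].

Definition gone : group_alg := gbasis 1%g.

Definition gmul a b : group_alg :=
  \sum_(g : gT) \sum_(h : gT) (a g * b h) *: gbasis (g * h)%g.

Lemma gmulE a b k : gmul a b k = \sum_(g : gT) a g * b (g^-1 * k)%g.
Proof.
rewrite /gmul sum_ffunE; apply: eq_bigr => g _.
rewrite sum_ffunE (bigD1 (g^-1 * k)%g) //= !ffunE mulKVg eqxx.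
rewrite big1 ?addr0 => [|h hk]; first by rewrite /GRing.scale /= mulr1.
rewrite !ffunE; case: (k =P _) hk => [-> | _ _]; first by rewrite mulKg eqxx.
exact: mulr0.
Qed.

Fact gmulA : associative gmul.
Proof.
move=> a b c; apply/ffunP=> k; rewrite !gmulE.
under eq_bigr => g _ do rewrite gmulE mulr_sumr.
under [RHS]eq_bigr => g _ do rewrite gmulE mulr_suml.
rewrite [RHS]exchange_big /=; apply: eq_bigr => g _.
rewrite [RHS](reindex_inj (mulgI g)) /=; apply: eq_bigr => h _.
by rewrite mulKg invMg mulgA mulrA.
Qed.

Fact gmul1r : left_id gone gmul.
Proof.
move=> a; apply/ffunP=> k; rewrite gmulE (bigD1 1%g) //= !ffunE eqxx mul1r.
rewrite invg1 mul1g big1 ?addr0 // => g /negPf g1.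
by rewrite ffunE g1 mul0r.
Qed.

Fact gmulr1 : right_id gone gmul.
Proof.
move=> a; apply/ffunP=> k; rewrite gmulE (bigD1 k) //= !ffunE mulVg eqxx mulr1.
rewrite big1 ?addr0 // => g gk.
rewrite ffunE; case: (_ =P 1%g) gk => [e | _ _]; last exact: mulr0.
by rewrite -[k](mulKVg g) e mulg1 eqxx.
Qed.

Fact gmulDl : left_distributive gmul +%R.
Proof.
move=> a b c; apply/ffunP=> k; rewrite !(gmulE, ffunE) -big_split /=.
by apply: eq_bigr => g _; rewrite ffunE mulrDl.
Qed.

Fact gmulDr : right_distributive gmul +%R.
Proof.
move=> a b c; apply/ffunP=> k; rewrite !(gmulE, ffunE) -big_split /=.
by apply: eq_bigr => g _; rewrite ffunE mulrDr.
Qed.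

Fact gone_neq0 : gone != 0.
Proof.
by apply/eqP=> /ffunP/(_ 1%g)/eqP; rewrite !ffunE eqxx oner_eq0.
Qed.

HB.instance Definition _ := GRing.Zmodule_isNzRing.Build group_alg
  gmulA gmul1r gmulr1 gmulDl gmulDr gone_neq0.

Fact gscalerAl (s : F) a b : s *: (a * b) = s *: a * b.
Proof.
apply/ffunP=> k; rewrite ffunE !gmulE scaler_sumr.
by apply: eq_bigr => g _; rewrite ffunE scalerAl.
Qed.

Fact gscalerAr (s : F) a b : s *: (a * b) = a * (s *: b).
Proof.
apply/ffunP=> k; rewrite ffunE !gmulE scaler_sumr.
by apply: eq_bigr => g _; rewrite ffunE scalerAr.
Qed.

HB.instance Definition _ := GRing.Lmodule_isLalgebra.Build F group_alg gscalerAl.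
HB.instance Definition _ := GRing.Lalgebra_isAlgebra.Build F group_alg gscalerAr.
HB.instance Definition _ := Algebra_isFalgebra.Build F group_alg.

Lemma gbasisM g h : gbasis g * gbasis h = gbasis (g * h)%g.
Proof.
apply/ffunP=> k; rewrite gmulE (bigD1 g) //= !ffunE eqxx mul1r.
rewrite big1 ?addr0 => [|i /negPf ig]; last by rewrite !ffunE ig mul0r.
by rewrite -(inj_eq (mulgI g)) mulKVg.
Qed.

End GroupAlgebra.

(* D_X(G): a function a : X * G -> F stands for the element
   \sum_(x, g) a (x, g) (e(x) \otimes g) of F[X]^* \otimes F[G]. *)
Section DoubleAlgebra.
Variables (F : fieldType) (gT : finGroupType) (X : lset gT).

Definition double_alg : Type := {ffun X * gT -> F^o}.
HB.instance Definition _ := Vector.copy double_alg {ffun X * gT -> F^o}.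
Implicit Types a b c : double_alg.

Definition dbasis (x : X) (g : gT) : double_alg :=
  [ffun u => (u == (x, g))%:R].

Definition done_ : double_alg := \sum_(x : X) dbasis x 1%g.

Definition dmul a b : double_alg :=
  \sum_(u : X * gT) \sum_(v : X * gT)
    (a u * b v * (u.1 == lact u.2 v.1)%:R) *: dbasis u.1 (u.2 * v.2)%g.

Lemma lactK g : cancel (@lact _ X g) (lact g^-1%g).
Proof. by move=> x; rewrite -lactM mulVg lact1. Qed.

Lemma lactKV g : cancel (@lact _ X g^-1%g) (lact g).
Proof. by move=> x; rewrite -lactM mulgV lact1. Qed.

Lemma doneE x k : done_ (x, k) = (k == 1%g)%:R.
Proof.
rewrite /done_ sum_ffunE (bigD1 x) //= ffunE xpair_eqE eqxx /=.
rewrite big1 ?addr0 // => y /negPf yx.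
by rewrite ffunE xpair_eqE eq_sym yx.
Qed.

Lemma dmulE a b x k :
  dmul a b (x, k) = \sum_(g : gT) a (x, g) * b (lact g^-1%g x, (g^-1 * k)%g).
Proof.
pose t (u v : X * gT) := a u * b v * (u.1 == lact u.2 v.1)%:R *
  ((x, k) == (u.1, (u.2 * v.2)%g))%:R.
have -> : dmul a b (x, k) = \sum_u \sum_v t u v.
  rewrite /dmul sum_ffunE; apply: eq_bigr => u _.
  by rewrite sum_ffunE; apply: eq_bigr => v _; rewrite !ffunE.
transitivity (\sum_(y : X) \sum_(g : gT) \sum_v t (y, g) v).
  by rewrite [RHS]pair_bigA; apply: eq_bigr => -[].
rewrite (bigD1 x) //=.
rewrite [X in _ + X]big1 ?addr0 => [|y /negPf yx]; last first.
  apply: big1 => g _; apply: big1 => v _.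
  by rewrite /t /= xpair_eqE [x == y]eq_sym yx mulr0.
apply: eq_bigr => g _; rewrite (bigD1 (lact g^-1%g x, (g^-1 * k)%g)) //=.
rewrite /t /= lactKV mulKVg !eqxx !mulr1 big1 ?addr0 // => -[y h] /= ne.
rewrite xpair_eqE eqxx /=.
case: eqP => [xy | _]; last by rewrite mulr0 mul0r.
case: eqP => [kh | _]; last by rewrite mulr0.
by case/negP: ne; rewrite xy kh lactK mulKg.
Qed.

Fact dmulA : associative dmul.
Proof.
move=> a b c; apply/ffunP=> -[x k]; rewrite !dmulE.
under eq_bigr => g _ do rewrite dmulE mulr_sumr.
under [RHS]eq_bigr => g _ do rewrite dmulE mulr_suml.
rewrite [RHS]exchange_big /=; apply: eq_bigr => g _.
rewrite [RHS](reindex_inj (mulgI g)) /=; apply: eq_bigr => h _.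
by rewrite mulKg invMg lactM mulgA mulrA.
Qed.

Fact dmul1r : left_id done_ dmul.
Proof.
move=> a; apply/ffunP=> -[x k]; rewrite dmulE (bigD1 1%g) //= doneE eqxx mul1r.
rewrite invg1 mul1g lact1 big1 ?addr0 // => g /negPf g1.
by rewrite doneE g1 mul0r.
Qed.

Fact dmulr1 : right_id done_ dmul.
Proof.
move=> a; apply/ffunP=> -[x k]; rewrite dmulE (bigD1 k) //= doneE mulVg eqxx.
rewrite mulr1 big1 ?addr0 // => g gk.
rewrite doneE; case: (_ =P 1%g) gk => [e | _ _]; last exact: mulr0.
by rewrite -[k](mulKVg g) e mulg1 eqxx.
Qed.

Fact dmulDl : left_distributive dmul +%R.
Proof.
move=> a b c; apply/ffunP=> -[x k]; rewrite ffunE !dmulE -big_split /=.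
by apply: eq_bigr => g _; rewrite ffunE mulrDl.
Qed.

Fact dmulDr : right_distributive dmul +%R.
Proof.
move=> a b c; apply/ffunP=> -[x k]; rewrite ffunE !dmulE -big_split /=.
by apply: eq_bigr => g _; rewrite ffunE mulrDr.
Qed.

Fact done_neq0 : done_ != 0.
Proof.
have /card_gt0P[x _] := lset_gt0 X.
by apply/eqP=> /ffunP/(_ (x, 1%g))/eqP; rewrite doneE ffunE eqxx oner_eq0.
Qed.

HB.instance Definition _ := GRing.Zmodule_isNzRing.Build double_alg
  dmulA dmul1r dmulr1 dmulDl dmulDr done_neq0.

Fact dscalerAl (s : F) a b : s *: (a * b) = s *: a * b.
Proof.
apply/ffunP=> -[x k]; rewrite ffunE !dmulE scaler_sumr.
by apply: eq_bigr => g _; rewrite ffunE scalerAl.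
Qed.

Fact dscalerAr (s : F) a b : s *: (a * b) = a * (s *: b).
Proof.
apply/ffunP=> -[x k]; rewrite ffunE !dmulE scaler_sumr.
by apply: eq_bigr => g _; rewrite ffunE scalerAr.
Qed.

HB.instance Definition _ :=
  GRing.Lmodule_isLalgebra.Build F double_alg dscalerAl.
HB.instance Definition _ :=
  GRing.Lalgebra_isAlgebra.Build F double_alg dscalerAr.
HB.instance Definition _ := Algebra_isFalgebra.Build F double_alg.

Lemma dbasisM x y g h :
  dbasis x g * dbasis y h = (x == lact g y)%:R *: dbasis x (g * h)%g.
Proof.
apply/ffunP=> -[z k]; rewrite dmulE (bigD1 g) //= !ffunE.
rewrite big1 ?addr0 => [|i /negPf ig]; last first.
  by rewrite !ffunE !xpair_eqE ig andbF mul0r.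
rewrite !xpair_eqE eqxx andbT /GRing.scale /=.
have -> : (lact g^-1%g z == y) = (z == lact g y).
  by rewrite -(inj_eq (can_inj (lactK g))) lactKV.
have -> : (g^-1 * k == h)%g = (k == g * h)%g.
  by rewrite -(inj_eq (mulgI g)) mulKVg.
case: (z =P x) => [-> | _]; last by rewrite mul0r mulr0.
by rewrite mul1r -natrM mulnb.
Qed.

End DoubleAlgebra.

Definition quantum_double (F : fieldType) (gT : finGroupType) : falgType F :=
  double_alg F (lset_conj gT).

Definition M_pair (F : fieldType) (p : nat) (A B : falgType F) : Prop :=
  mu A p = mu B p.

(* The Sylow subgroup P is universally quantified; all choices of P are
   conjugate, so this agrees with fixing one P for each group. *)
Definition MC1 (F : fieldType) (p : nat) : Prop :=
  forall (gT : finGroupType) (P : {group gT}), (p.-Sylow([set: gT]) P)%g ->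
    M_pair p (group_alg F gT) (group_alg F (subg_of 'N(P)%G)).

Definition MCD (F : fieldType) (p : nat) : Prop :=
  forall (gT : finGroupType) (P : {group gT}), (p.-Sylow([set: gT]) P)%g ->
    M_pair p (quantum_double F gT) (quantum_double F (subg_of 'N(P)%G)).

Definition MCX (F : fieldType) (p : nat) : Prop :=
  forall (gT : finGroupType) (P : {group gT}), (p.-Sylow([set: gT]) P)%g ->
    forall X : lset gT,
      M_pair p (double_alg F X) (double_alg F (lset_restr 'N(P)%G X)).

Definition MCT (F : fieldType) (p : nat) : Prop :=
  forall (gT : finGroupType) (P : {group gT}), (p.-Sylow([set: gT]) P)%g ->
    forall X : lset gT, ltransitive X ->
      M_pair p (double_alg F X) (double_alg F (lset_restr 'N(P)%G X)).

(* Main.v *)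
From HB Require Import structures.
From mathcomp Require Import all_boot all_order all_algebra all_fingroup.
From mathcomp Require Import all_solvable all_field reals complex.
From mathcomp Require boolp.
Require Import Defs.

Set Implicit Arguments.
Unset Strict Implicit.
Unset Printing Implicit Defensive.

Import GRing.Theory.
Local Open Scope ring_scope.

(** All four statements compare numbers of simple modules, and the algebras
    D_X(G) reduce to group algebras of stabilizers.  Write e(x) for the
    idempotent e(x) (x) 1 of A = D_X(G).  These are orthogonal with sum 1, so a
    module M is the direct sum of the e(x)M, which the elements of G permute as
    they permute X; if M is simple, the x with e(x)M <> 0 form one orbit.  The
    corner e(x)Ae(x) is the group algebra of the stabilizer G_x, and simple
    modules of a corner eAe correspond to the simple A-modules M with eM <> 0
    through M |-> eM.  So simple A-modules are pairs of an orbit Gx and a simple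
    G_x-module V, of dimension |Gx| dim V, and mu(D_X(G)) is the sum of
    mu(C[G_x]) over the orbits of length prime to p ([mu_double_orbits]).

    Let P be a Sylow p-subgroup and N its normalizer.  An orbit of G, or of N,
    has length prime to p exactly when it contains a point fixed by P, and two
    such points in one G-orbit are in one N-orbit, by Burnside's fusion argument.
    Hence one set of representatives x, a transversal of the N-orbits on the
    P-fixed points of X, serves for both groups.  Moreover P is a Sylow
    p-subgroup of G_x, and N_x is its normalizer in G_x.  So
    mu(D_X(G)) and mu(D_X(N)) are sums over the same x of mu(C[G_x]) and of
    mu(C[N_{G_x}(P)]) ([mu_double_sylow], [mu_double_norm]).

    If MC1 holds, the two sums agree term by term; this gives MCX.  It gives MCD
    as well: the elements of G fixed by P under conjugation form C_G(P), which
    lies in N, so D(N) has the same sum as D_X(N) for X = G under conjugation.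
    MCT contains MC1 as the case of a one-point set.  Finally MCD implies MC1 by
    induction on |G|: in the two sums for D(G) and D(N) the terms of
    noncentral elements agree by induction, as their centralizers are proper,
    and what is left is a positive multiple, the number of central
    representatives, of mu(C[G]) on one side and of mu(C[N]) on the other. *)

(** * Building modules *)

Section ModuleOf.
Variables (F : fieldType) (A : falgType F) (V : vectType F) (act : A -> V -> V).
Hypotheses (act_linearl : forall v, linear (act^~ v))
  (act_linearr : forall a, linear (act a)) (act1 : forall v, act 1 v = v)
  (actM : forall a b v, act (a * b) v = act a (act b v)).

Definition act_lfun (a : A) : 'End(V) := linfun (act a).

Lemma act_lfunE a v : act_lfun a v = act a v.
Proof.
pose l := GRing.isLinear.Build F V V _ _ (act_linearr a).
pose f : {linear V -> V} := HB.pack (act a) l.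
exact: (lfunE f).
Qed.

Fact act_lfun_linear : linear act_lfun.
Proof.
by move=> c a b; apply/lfunP=> v; rewrite add_lfunE scale_lfunE !act_lfunE act_linearl.
Qed.

HB.instance Definition _ := GRing.isLinear.Build F A 'End(V) _ _ act_lfun_linear.

Fact act_lfun1 : act_lfun 1 = \1%VF.
Proof. by apply/lfunP=> v; rewrite act_lfunE act1 id_lfunE. Qed.

Fact act_lfunM a b : act_lfun (a * b) = (act_lfun a \o act_lfun b)%VF.
Proof. by apply/lfunP=> v; rewrite comp_lfunE !act_lfunE actM. Qed.

Definition module_of : amodule A :=
  @AModule F A V act_lfun act_lfun1 act_lfunM.

Lemma module_ofE a (v : module_of) : mact module_of a v = act a v.
Proof. exact: act_lfunE. Qed.

End ModuleOf.

Section Modules.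
Variables (F : fieldType) (A : falgType F).
Implicit Types M N : amodule A.

Lemma mact1E M (v : M) : mact M 1 v = v.
Proof. by rewrite mact1 id_lfunE. Qed.

Lemma mact_img M a (v : M) : mact M a v \in limg (mact M a).
Proof. by rewrite memv_img ?memvf. Qed.

(** A module is simple exactly when every nonzero vector generates it; this
    elementwise form is the one in which simplicity is checked below. *)
Lemma simple_moduleP M :
  simple_module M <->
  (exists v : M, v != 0) /\
  (forall v w : M, v != 0 -> exists a, mact M a v = w).
Proof.
split=> [[ex sM]|[ex gM]]; split=> //.
  move=> v w v0; have vv : v \in limg (mev v).
    by apply/memv_imgP; exists 1; rewrite ?memvf // mevE mact1E.
  case: (sM (limg (mev v))) => [a _ /memv_imgP[b _ ->]|l0|lT].
  - by rewrite mevE -mactME -mevE memv_img ?memvf.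
  - by move: vv; rewrite l0 memv0 (negPf v0).
  - have /memv_imgP[a _ ->] : w \in limg (mev v) by rewrite lT memvf.
    by exists a; rewrite mevE.
move=> U sU; case: (eqVneq U 0%VS) => [|U0]; [by left|right].
apply/vspaceP=> w; rewrite memvf.
have [|a <-] := gM (vpick U) w; first by rewrite vpick0.
by rewrite sU ?memv_pick.
Qed.

Lemma module_iso_dim M N : module_iso M N -> \dim {:M} = \dim {:N}.
Proof.
case=> f [[g fK gK] _]; have /lker0P/eqP kf := can_inj fK.
rewrite -(limg_dim_eq (f := f)) ?kf ?capv0 //; congr (\dim _).
by apply/vspaceP=> v; rewrite memvf -[v]gK memv_img ?memvf.
Qed.

Lemma module_iso_mact M N a : module_iso M N -> mact M a != 0 -> mact N a != 0.
Proof.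
case=> f [bf fA]; apply: contraNneq => Na0; apply/eqP/lfunP=> v.
by apply: (bij_inj bf); rewrite fA Na0 !zero_lfunE linear0.
Qed.

Lemma mact_neq0P M a : reflect (exists v, mact M a v != 0) (mact M a != 0).
Proof.
apply: (iffP idP) => [Ma0|[v]]; last first.
  by apply: contraNneq => ->; rewrite zero_lfunE.
apply: boolp.contrapT => nex; case/eqP: Ma0; apply/lfunP=> v; rewrite zero_lfunE.
by apply/eqP; apply: boolp.contrapT => /negP v0; apply: nex; exists v.
Qed.

Lemma mu_eq_card p (I : finType) (M : I -> amodule A) :
    (forall i, mu_module p (M i)) ->
    (forall i j, module_iso (M i) (M j) -> i = j) ->
    (forall S, mu_module p S -> exists i, module_iso S (M i)) ->
  mu A p = #|I|.
Proof.
move=> sM uM cM; apply: (mu_spec_uniq (muP A p)).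
exists (fun i => M (enum_val i)); split; first split=> [i|i j /uM].
- exact: sM.
- exact: enum_val_inj.
by move=> S /cM[i iS]; exists (enum_rank i); rewrite enum_rankK.
Qed.

(** The submodule A.f generated by f, as a module in its own right. *)
Section Cyclic.
Variables (M : amodule A) (f : M).

Definition cyclic_act (a : A) (v : subvs_of (limg (mev f))) :=
  vsproj (limg (mev f)) (mact M a (vsval v)).

Fact cyclic_actE a v : vsval (cyclic_act a v) = mact M a (vsval v).
Proof.
rewrite /cyclic_act vsprojK //; have /memv_imgP[b _ ->] := subvsP v.
by rewrite mevE -mactME -mevE memv_img ?memvf.
Qed.

Fact cyclic_linearl v : linear (cyclic_act^~ v).
Proof.
move=> c a b; apply: val_inj.
by rewrite linearP /= !cyclic_actE linearP add_lfunE scale_lfunE.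
Qed.

Fact cyclic_linearr a : linear (cyclic_act a).
Proof. by move=> c u v; apply: val_inj; rewrite linearP /= !cyclic_actE !linearP. Qed.

Fact cyclic_act1 v : cyclic_act 1 v = v.
Proof. by apply: val_inj; rewrite /= cyclic_actE mact1E. Qed.

Fact cyclic_actM a b v : cyclic_act (a * b) v = cyclic_act a (cyclic_act b v).
Proof. by apply: val_inj; rewrite /= !cyclic_actE mactME. Qed.

Definition cyclic_module : amodule A :=
  module_of cyclic_linearl cyclic_linearr cyclic_act1 cyclic_actM.

Lemma cyclic_moduleE a (v : cyclic_module) :
  vsval (mact cyclic_module a v) = mact M a (vsval v).
Proof. by rewrite module_ofE cyclic_actE. Qed.

Lemma cyclic_moduleP (v : cyclic_module) : exists a, vsval v = mact M a f.
Proof. by have /memv_imgP[a _ ->] := subvsP v; exists a; rewrite mevE. Qed.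

Lemma cyclic_gen : exists v : cyclic_module, vsval v = f.
Proof.
exists (vsproj _ f : cyclic_module); rewrite vsprojK //.
by apply/memv_imgP; exists 1; rewrite ?memvf // mevE mact1E.
Qed.

End Cyclic.
End Modules.

(** * Simple modules of a corner algebra *)

Section Corner.
Variables (F : fieldType) (A B : falgType F) (iota : 'Hom(B, A)).
Hypotheses (iotaM : forall a b, iota (a * b) = iota a * iota b)
  (iota_inj : lker iota == 0%VS)
  (iota_corner : forall a, exists b, iota b = iota 1 * a * iota 1).

Notation e := (iota 1).

Section Restriction.
Variable M : amodule A.

Definition corner_act (b : B) (v : subvs_of (limg (mact M e))) :=
  vsproj (limg (mact M e)) (mact M (iota b) (vsval v)).

Fact corner_actE b v : vsval (corner_act b v) = mact M (iota b) (vsval v).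
Proof.
rewrite /corner_act vsprojK //.
by rewrite -[iota b](congr1 iota (mul1r b)) iotaM mactME mact_img.
Qed.

Fact corner_linearl v : linear (corner_act^~ v).
Proof.
move=> c a b; apply: val_inj.
by rewrite linearP /= !corner_actE !linearP add_lfunE scale_lfunE.
Qed.

Fact corner_linearr a : linear (corner_act a).
Proof. by move=> c u v; apply: val_inj; rewrite linearP /= !corner_actE !linearP. Qed.

Fact corner_actM a b v : corner_act (a * b) v = corner_act a (corner_act b v).
Proof. by apply: val_inj; rewrite /= !corner_actE iotaM mactME. Qed.

Lemma mact_corner_id (v : M) : v \in limg (mact M e) -> mact M e v = v.
Proof. by case/memv_imgP=> w _ ->; rewrite -mactME -iotaM mulr1. Qed.

Fact corner_act1 v : corner_act 1 v = v.
Proof. by apply: val_inj; rewrite /= corner_actE mact_corner_id ?subvsP. Qed.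

Definition corner_module : amodule B :=
  module_of corner_linearl corner_linearr corner_act1 corner_actM.

Lemma corner_moduleE b (v : corner_module) :
  vsval (mact corner_module b v) = mact M (iota b) (vsval v).
Proof. by rewrite module_ofE corner_actE. Qed.

Lemma corner_id (v : corner_module) : mact M e (vsval v) = vsval v.
Proof. exact/mact_corner_id/subvsP. Qed.

Lemma corner_vec (v : M) : exists u : corner_module, vsval u = mact M e v.
Proof. by exists (vsproj _ (mact M e v) : corner_module); rewrite vsprojK ?mact_img. Qed.

Lemma corner_module_neq0 : (exists v : corner_module, v != 0) <-> mact M e != 0.
Proof.
split=> [[v v0]|/mact_neq0P[v v0]].
  by apply/mact_neq0P; exists (vsval v); rewrite corner_id.
by have [u uE] := corner_vec v; exists u; apply: contraNneq v0 => u0; rewrite -uE u0.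
Qed.

Lemma dim_corner_module : \dim {: corner_module} = \dim (limg (mact M e)).
Proof. by rewrite dimvf. Qed.

(** If [a] carries [v] to [w] and both lie in [eM], so does [eae]. *)
Lemma corner_module_simple :
  simple_module M -> mact M e != 0 -> simple_module corner_module.
Proof.
move=> /simple_moduleP[_ gM] /corner_module_neq0 e0; apply/simple_moduleP.
split=> // v w v0; have [a aE] := gM (vsval v) (vsval w) v0.
have [b bE] := iota_corner a; exists b; apply: val_inj.
by rewrite /= corner_moduleE bE !mactME corner_id aE corner_id.
Qed.

End Restriction.

Lemma corner_module_iso (M N : amodule A) :
  module_iso M N -> module_iso (corner_module M) (corner_module N).
Proof.
case=> f [[g fK gK] fA].
have gA a v : g (mact N a v) = mact M a (g v).
  by rewrite -[v in LHS]gK -fA fK.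
pose h (u : corner_module M) : corner_module N :=
  vsproj (limg (mact N e)) (f (vsval u)).
have hE u : vsval (h u) = f (vsval u).
  by rewrite vsprojK // -(corner_id u) fA mact_img.
have h_lin : linear h by move=> c u v; apply: val_inj; rewrite linearP /= !hE linearP.
pose l := GRing.isLinear.Build F _ _ _ _ h_lin.
pose h' : {linear corner_module M -> corner_module N} := HB.pack h l.
have h'E u : linfun h' u = h u by rewrite lfunE.
exists (linfun h'); split=> [|b u]; last first.
  by rewrite !h'E; apply: val_inj; rewrite /= !(hE, corner_moduleE) fA.
exists (fun u : corner_module N => vsproj (limg (mact M e)) (g (vsval u)) : corner_module M)
  => u; rewrite ?h'E; apply: val_inj; rewrite /=.
  by rewrite vsprojK hE fK // subvsP.
by rewrite hE vsprojK ?gK // -(corner_id u) gA mact_img.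
Qed.

(** A simple module is recovered from its corner: for [v] in [eM] and its image
    [w] in [eN], the annihilators of [v] and [w] in the left ideal [Ae]
    agree, because [N] has no nonzero vector [u] with [eAu = 0]. *)
Lemma corner_module_iso_inj (M N : amodule A) :
    simple_module M -> simple_module N -> mact M e != 0 ->
  module_iso (corner_module M) (corner_module N) -> module_iso M N.
Proof.
move=> sM sN /corner_module_neq0[v v0] [f [bf fA]].
have f0 u : (f u == 0) = (u == 0) by rewrite -(inj_eq (bij_inj bf)) linear0.
have w0 : f v != 0 by rewrite f0.
have /simple_moduleP[_ gN] := sN.
pose J := limg (amulr e).
have JP b : b \in J -> b * e = b.
  by case/memv_imgP=> c _ ->; rewrite lfunE /= -mulrA -iotaM mulr1.
have Je : e \in J by apply/memv_imgP; exists 1; rewrite ?memvf // lfunE /= mul1r.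
apply: (@ideal_iso _ _ M N (vsval v) (vsval (f v)) J) => //.
- move=> a b /memv_imgP[c _ ->]; apply/memv_imgP; exists (a * c); rewrite ?memvf //.
  by rewrite !lfunE /= mulrA.
- by apply/negP=> /subvP/(_ e Je); rewrite memv_ker mevE corner_id; exact/negP.
- by apply/negP=> /subvP/(_ e Je); rewrite memv_ker mevE corner_id; exact/negP.
apply/subvP=> a; rewrite memv_cap !memv_ker !mevE => /andP[Ja /eqP av0].
apply/negP=> /negP aw0; have [c cE] := gN _ (vsval (f v)) aw0.
case/negP: w0; apply/eqP/val_inj; rewrite /= -corner_id -cE.
have [b bE] := iota_corner (c * a).
have {}bE : iota b = e * (c * a) by rewrite bE -!mulrA (JP a Ja).
rewrite -[mact N c _]mactME -[mact N e _]mactME -bE -corner_moduleE -fA.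
suff -> : mact (corner_module M) b v = 0 by rewrite !linear0.
by apply: val_inj; rewrite /= corner_moduleE bE !mactME av0 !linear0.
Qed.

Section Induction.
Variable V : amodule B.

Definition coind_act (c : A) (f : 'Hom(A, V)) : 'Hom(A, V) := (f \o amulr c)%VF.

Fact coind_actE c f a : coind_act c f a = f (a * c).
Proof. by rewrite comp_lfunE lfunE. Qed.

Fact coind_linearl f : linear (coind_act^~ f).
Proof.
move=> c a b; apply/lfunP=> x.
by rewrite add_lfunE scale_lfunE !coind_actE mulrDr -scalerAr linearP.
Qed.

Fact coind_linearr c : linear (coind_act c).
Proof.
move=> k f g; apply/lfunP=> x.
by rewrite !(add_lfunE, scale_lfunE, coind_actE).
Qed.

Fact coind_act1 f : coind_act 1 f = f.
Proof. by apply/lfunP=> x; rewrite coind_actE mulr1. Qed.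

Fact coind_actM a b f : coind_act (a * b) f = coind_act a (coind_act b f).
Proof. by apply/lfunP=> x; rewrite !coind_actE mulrA. Qed.

Definition coind_module : amodule A :=
  module_of coind_linearl coind_linearr coind_act1 coind_actM.

(** The map a |-> (eae).v, where the corner element eae is read in B. *)
Definition coind_vec (v : V) : coind_module :=
  (mev v \o iota^-1 \o amull e \o amulr e)%VF.

Lemma coind_moduleE c (f : coind_module) a :
  (mact coind_module c f : 'Hom(A, V)) a = (f : 'Hom(A, V)) (a * c).
Proof. by rewrite module_ofE coind_actE. Qed.

Lemma coind_vecE v a b :
  iota b = e * a * e -> (coind_vec v : 'Hom(A, V)) a = mact V b v.
Proof.
move=> bE; rewrite /coind_vec !comp_lfunE !lfunE /= mulrA -bE.
by rewrite lker0_lfunK // mevE.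
Qed.

End Induction.

(** Every simple module of the corner is a corner of a simple module.  In the
    module ['Hom(A, V)], on which [c] acts by precomposition with
    right multiplication by [c], the map [f0 := a |-> (eae).v]
    generates the required module: if [a.f0] is nonzero then some
    [(ebae).v] is nonzero, simplicity of [V] brings it back to [v] by an element
    [d] of the corner, and [d b a.f0 = f0]. *)
Lemma corner_module_surj (V : amodule B) : simple_module V ->
  exists M : amodule A, [/\ simple_module M, mact M e != 0 &
    module_iso (corner_module M) V].
Proof.
move=> /simple_moduleP[[v v0] gV].
pose f0 := coind_vec v; pose M := cyclic_module f0.
have f0E a b : iota b = e * a * e -> (f0 : 'Hom(A, V)) a = mact V b v.
  exact: coind_vecE.
have ee : e * e = e by rewrite -iotaM mulr1.
have eb b : e * iota b = iota b by rewrite -iotaM mul1r.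
have be b : iota b * e = iota b by rewrite -iotaM mulr1.
pose ev (u : M) (a : A) : V := (vsval u : 'Hom(A, V)) a.
have evM c u a : ev (mact M c u) a = ev u (a * c).
  by rewrite /ev cyclic_moduleE coind_moduleE.
have ev_inj u w : (forall a, ev u a = ev w a) -> u = w.
  by move=> uw; apply: val_inj; apply/lfunP.
have ev0 u : (forall a, ev u a = 0) -> u = 0.
  by move=> u0; apply: ev_inj => a; rewrite u0 /ev /= zero_lfunE.
have [g gE] := cyclic_gen f0.
have evg a b : iota b = e * a * e -> ev g a = mact V b v.
  by rewrite /ev gE; exact: f0E.
have evP u : exists c, u = mact M c g.
  have [c cE] := cyclic_moduleP u; exists c; apply: val_inj.
  by rewrite [RHS](cyclic_moduleE c g) gE.
have ge : mact M e g = g.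
  apply: ev_inj => a; rewrite evM; have [b bE] := iota_corner a.
  by rewrite !(evg _ b) // bE -!mulrA ee.
have g0 : g != 0.
  apply: contraNneq v0 => g0.
  by rewrite -(mact1E v) -(evg 1 1) ?mulr1 ?ee // g0 /ev /= zero_lfunE.
have sM : simple_module M.
  apply/simple_moduleP; split=> [|u w u0]; first by exists g.
  have [c uE] := evP u; have [c' ->] := evP w.
  have [a a0] : exists a, ev u a != 0.
    apply: boolp.contrapT => nex; case/eqP: u0; apply: ev0 => a.
    by apply/eqP; apply: boolp.contrapT => /negP a0; apply: nex; exists a.
  have [b bE] := iota_corner (a * c).
  move: a0; rewrite uE evM (evg _ b) // => bv0.
  have [d dE] := gV _ v bv0.
  exists (c' * (iota d * a)); rewrite mactME -uE; congr (mact M c' _).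
  rewrite uE -mactME; apply: ev_inj => x; rewrite evM.
  have [y yE] := iota_corner x.
  rewrite (evg x y) // (evg _ (y * (d * b))); first by rewrite !mactME dE.
  by rewrite !iotaM yE bE !mulrA -(mulrA (e * x)) eb -(mulrA (e * x)) be.
have e0 : mact M e != 0 by apply/mact_neq0P; exists g; rewrite ge.
exists M; split=> //.
(* Evaluation at 1 sends the element (c.f0) of eM to (ece).v. *)
pose h (u : corner_module M) : V := ev (vsval u) 1.
have h_lin : linear h.
  by move=> c u w; rewrite /h /ev !linearP /= add_lfunE scale_lfunE.
pose l := GRing.isLinear.Build F _ _ _ _ h_lin.
pose h' : {linear corner_module M -> V} := HB.pack h l.
have h'E u : linfun h' u = h u by rewrite lfunE.
apply: (@simple_hom_iso _ _ _ _ (linfun h')).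
- exact: corner_module_simple.
- by apply/simple_moduleP; split=> //; exists v.
- move=> b u; rewrite !h'E /h corner_moduleE evM mul1r.
  have [c uE] := evP (vsval u); have [d dE] := iota_corner c.
  rewrite uE !evM mul1r (evg _ (b * d)) ?(evg _ d) ?mactME //.
  by rewrite iotaM dE !mulrA eb be.
have [u uE] := corner_vec g; apply: contraNneq v0 => h0.
by rewrite -(mact1E v) -(evg 1 1) ?mulr1 ?ee // -ge -uE -[ev _ _]/(h u) -h'E h0 zero_lfunE.
Qed.

End Corner.

(** * Simple modules of the algebras D_X(G) *)

(** Here the stabilizer of x is any group embedded in G by f with that image: the
    same point x will be used with stabilizers formed inside G, inside N, and
    inside subgroup types of these. *)
Section StabilizerCorner.
Variables (F : fieldType) (gT hT : finGroupType) (X : lset gT) (x : X).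
Variable f : hT -> gT.
Hypotheses (fM : forall h k, f (h * k)%g = (f h * f k)%g) (f_inj : injective f)
  (f_stab : forall g, (lact g x == x) = (g \in codom f)).

Definition stab_map (a : group_alg F hT) : double_alg F X :=
  \sum_(h : hT) (a h : F) *: dbasis F x (f h).

Fact stab_map_linear : linear stab_map.
Proof.
move=> c a b; rewrite /stab_map scaler_sumr -big_split; apply: eq_bigr => h _.
by rewrite !ffunE scalerDl scalerA.
Qed.

HB.instance Definition _ :=
  GRing.isLinear.Build F (group_alg F hT) (double_alg F X) _ _ stab_map_linear.

Definition stab_hom : 'Hom(group_alg F hT, double_alg F X) := linfun stab_map.

Fact stab_homE a : stab_hom a = \sum_(h : hT) (a h : F) *: dbasis F x (f h).
Proof. by rewrite lfunE. Qed.

Lemma stab_hom_coef a h : stab_hom a (x, f h) = a h.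
Proof.
rewrite stab_homE sum_ffunE (bigD1 h) //= !ffunE eqxx big1 => [|k /negPf kh].
  by rewrite addr0; exact: mulr1.
by rewrite !ffunE xpair_eqE eqxx (inj_eq f_inj) eq_sym kh; exact: mulr0.
Qed.

Lemma stab_hom_basis h : stab_hom (gbasis F h) = dbasis F x (f h).
Proof.
rewrite stab_homE (bigD1 h) //= ffunE eqxx scale1r big1 ?addr0 // => k /negPf kh.
by rewrite ffunE kh scale0r.
Qed.

Lemma stab_incl1 : f 1%g = 1%g.
Proof. by apply: (mulgI (f 1%g)); rewrite -fM !mulg1. Qed.

Lemma stab_hom1 : stab_hom 1 = dbasis F x 1%g.
Proof. by rewrite -stab_incl1; exact: stab_hom_basis. Qed.

Lemma stab_homM a b : stab_hom (a * b) = stab_hom a * stab_hom b.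
Proof.
rewrite [a * b]/(gmul a b) /gmul linear_sum /= !stab_homE mulr_suml.
apply: eq_bigr => h _; rewrite linear_sum /= mulr_sumr; apply: eq_bigr => k _.
rewrite linearZ /= stab_hom_basis -scalerAl -scalerAr scalerA dbasisM.
have fhx : lact (f h) x = x by apply/eqP; rewrite f_stab codom_f.
by rewrite fhx eqxx scale1r fM.
Qed.

Lemma stab_hom_inj : lker stab_hom == 0%VS.
Proof.
apply/lker0P=> a b ab; apply/ffunP=> h.
by rewrite -!stab_hom_coef ab.
Qed.

End StabilizerCorner.

Section DoubleModules.
Variables (F : fieldType) (gT : finGroupType) (X : lset gT).
Implicit Types (x y : X) (M N : amodule (double_alg F X)).

Notation e x := (dbasis F x 1%g).

Lemma dbasis1_mul y x (c : double_alg F X) z k :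
  (e y * c * e x) (z, k) = (z == y)%:R * c (z, k) * (lact k^-1%g z == x)%:R.
Proof.
rewrite [LHS]dmulE (bigD1 k) //= [X in _ + X]big1 ?addr0 => [|g gk]; last first.
  rewrite [dbasis F x _ _]ffunE xpair_eqE -eq_mulVg1 (negPf gk) andbF.
  exact: mulr0.
rewrite [dbasis F x _ _]ffunE xpair_eqE mulVg eqxx andbT; congr (_ * _).
rewrite [LHS]dmulE (bigD1 1%g) //= big1 ?addr0 => [|g /negPf g1].
  by rewrite ffunE xpair_eqE eqxx andbT invg1 mul1g lact1.
by rewrite ffunE xpair_eqE g1 andbF; exact: mul0r.
Qed.

Lemma stab_hom_corner (hT : finGroupType) x (f : hT -> gT) :
    injective f -> (forall g, (lact g x == x) = (g \in codom f)) ->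
  forall c : double_alg F X, exists b, stab_hom F x f b = e x * c * e x.
Proof.
move=> f_inj f_stab c; exists [ffun h => c (x, f h)].
apply/ffunP=> -[z k]; rewrite dbasis1_mul.
case: (z =P x) => [->|/eqP/negPf zx]; last first.
  rewrite stab_homE sum_ffunE big1 ?mul0r // => h _.
  by rewrite !ffunE xpair_eqE zx; exact: mulr0.
have -> : (lact k^-1%g x == x) = (k \in codom f).
  by rewrite -f_stab -(inj_eq (can_inj (lactK k))) lactKV eq_sym.
rewrite mul1r; have [/codomP[h ->]|kf] := boolP (k \in codom f).
  by rewrite stab_hom_coef // ffunE mulr1.
rewrite mulr0 stab_homE sum_ffunE big1 // => h _.
rewrite !ffunE xpair_eqE; case: (k =P f h) kf => [->|_ _]; first by rewrite codom_f.
by rewrite andbF; exact: mulr0.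
Qed.

Definition lorbit x : {set X} := [set lact g x | g : gT].

Lemma lorbit_refl x : x \in lorbit x.
Proof. by apply/imsetP; exists 1%g; rewrite ?lact1. Qed.

(** Conjugating e(x) by the group element g gives e(gx). *)
Lemma dim_fiber_lact M g x :
  \dim (limg (mact M (e (lact g x)))) = \dim (limg (mact M (e x))).
Proof.
have le h y : (\dim (limg (mact M (e (lact h y)))) <= \dim (limg (mact M (e y))))%N.
  rewrite -(limg_ker_dim (mact M (dbasis F (lact h y) h)) (limg (mact M (e y)))).
  apply: leq_trans (leq_addl _ _); apply/dimvS/subvP=> _ /memv_imgP[v _ ->].
  have -> : e (lact h y) = dbasis F (lact h y) h * (e y * dbasis F y h^-1%g).
    by rewrite dbasisM lact1 eqxx scale1r mul1g dbasisM eqxx scale1r mulgV.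
  by rewrite !mactME memv_img ?mact_img.
by apply/eqP; rewrite eqn_leq le /= -{1}(lactK g x) le.
Qed.

(** The e(x) are orthogonal idempotents with sum 1. *)
Lemma dim_fibers M : \dim {:M} = (\sum_x \dim (limg (mact M (e x))))%N.
Proof.
have eM x y (v : M) : v \in limg (mact M (e x)) -> mact M (e y) v = (y == x)%:R *: v.
  case/memv_imgP=> w _ ->; rewrite -mactME dbasisM lact1 mulg1.
  case: eqP => [->|_]; first by rewrite !scale1r.
  by rewrite !scale0r linear0 zero_lfunE.
have dx : directv (\sum_x limg (mact M (e x))).
  apply/directv_sum_independent => us usM us0 y _.
  have : mact M (e y) (\sum_x us x) = 0 by rewrite us0 linear0.
  rewrite linear_sum (bigD1 y) //= big1 => [|x xy].
    by rewrite (eM y) ?usM // eqxx scale1r addr0.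
  by rewrite (eM x) ?usM // eq_sym (negPf xy) scale0r.
rewrite -(directvP dx) /=; congr (\dim _); apply/vspaceP=> v; rewrite memvf.
have -> : v = \sum_x mact M (e x) v.
  by rewrite -[v in LHS]mact1E -sum_lfunE -linear_sum.
by rewrite memv_suml // => x _; apply: (subvP (sumv_sup x _ _)) (mact_img _ _).
Qed.

(** A nonzero e(y)Ae(x) forces y to lie in the orbit of x. *)
Lemma simple_double_support M x y : simple_module M ->
  mact M (e x) != 0 -> mact M (e y) != 0 -> y \in lorbit x.
Proof.
move=> /simple_moduleP[_ gM] /mact_neq0P[v v0] /mact_neq0P[w w0].
have [a aE] := gM _ (mact M (e y) w) v0.
have : e y * a * e x != 0.
  apply: contraNneq w0 => z.
  rewrite -[e y](_ : e y * e y = _) ?mactME -?aE -?mactME ?z ?linear0 ?zero_lfunE //.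
  by rewrite dbasisM lact1 eqxx scale1r mulg1.
apply: contraR => yx; apply/eqP/ffunP=> -[z k]; rewrite dbasis1_mul ffunE.
case: (z =P y) => [->|_]; last by rewrite !mul0r.
case: eqP => [kx|_]; last by rewrite mulr0.
by case/imsetP: yx; exists k => //; rewrite -kx lactKV.
Qed.

Lemma simple_double_fiber M : simple_module M -> exists x, mact M (e x) != 0.
Proof.
move=> [[v v0] _]; apply: boolp.contrapT => nex; case/eqP: v0.
rewrite -(mact1E v) [1]/(done_ F X) /done_ linear_sum sum_lfunE big1 // => x _.
apply/eqP; apply: boolp.contrapT => /negP xv; apply: nex; exists x.
by apply/mact_neq0P; exists v.
Qed.

Lemma dim_simple_double M x : simple_module M -> mact M (e x) != 0 ->
  \dim {:M} = (#|lorbit x| * \dim (limg (mact M (e x))))%N.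
Proof.
move=> sM x0; rewrite dim_fibers (bigID (mem (lorbit x))) /=.
rewrite [X in (_ + X)%N]big1 ?addn0 => [|y yx].
  rewrite -sum_nat_const; apply: eq_bigr => _ /imsetP[g _ ->].
  exact: dim_fiber_lact.
apply/eqP; rewrite dimv_eq0; apply: contraR yx => y0.
apply: (simple_double_support sM x0).
apply: contraNneq y0 => ->; apply/eqP; apply/vspaceP=> v; rewrite memv0.
by apply/memv_imgP/eqP=> [[w _ ->]|->]; [rewrite zero_lfunE|exists 0; rewrite ?memvf ?linear0].
Qed.

(** Up to isomorphism, the simple modules of D_X(G) are the pairs of an orbit Gx
    and a simple module V of the stabilizer of x; the dimension is |Gx| dim V,
    so only the orbits of length prime to p count.  The family r picks one point
    in each of them. *)
Lemma mu_double_orbits p (I : finType) (r : I -> X) (H : I -> finGroupType)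
    (f : forall i, H i -> gT) :
    (forall i h k, f i (h * k)%g = (f i h * f i k)%g) ->
    (forall i, injective (f i)) ->
    (forall i g, (lact g (r i) == r i) = (g \in codom (f i))) ->
    (forall i, coprime p #|lorbit (r i)|) ->
    (forall i j, r j \in lorbit (r i) -> i = j) ->
    (forall x, coprime p #|lorbit x| -> exists i, r i \in lorbit x) ->
  mu (double_alg F X) p = (\sum_i mu (group_alg F (H i)) p)%N.
Proof.
move=> fM fI fS rp rI rC.
pose io i := stab_hom F (r i) (f i) : 'Hom(group_alg F (H i), double_alg F X).
have io1 i : io i 1 = e (r i) by exact: stab_hom1.
have ioM i a b : io i (a * b) = io i a * io i b by exact: stab_homM.
have ioI i : lker (io i) == 0%VS by exact: stab_hom_inj.
have ioC i a : exists b, io i b = io i 1 * a * io i 1.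
  by rewrite io1; exact: stab_hom_corner.
have cdim i M : simple_module M -> mact M (io i 1) != 0 ->
    \dim {:M} = (#|lorbit (r i)| * \dim {: corner_module (ioM i) M})%N.
  by move=> sM; rewrite dim_corner_module io1; exact: dim_simple_double.
pose m i := mu (group_alg F (H i)) p.
pose V i := sval (boolp.cid (muP (group_alg F (H i)) p)).
have V_indep i : mu_indep p (V i) by have [] := svalP (boolp.cid (muP (group_alg F (H i)) p)).
have V_compl i S : mu_module p S -> exists k, module_iso S (V i k).
  by have [_] := svalP (boolp.cid (muP (group_alg F (H i)) p)); apply.
pose K := {i : I & 'I_(m i)}; pose inK i k : K := existT _ i k.
have /boolp.choice[N NP] (t : K) : exists M : amodule (double_alg F X),
    [/\ simple_module M, mact M (io (tag t) 1) != 0 &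
      module_iso (corner_module (ioM (tag t)) M) (V (tag t) (tagged t))].
  apply: (corner_module_surj (ioM _) (ioI _) (ioC _)).
  by have [/(_ (tagged t))[]] := V_indep (tag t).
have -> : (\sum_i mu (group_alg F (H i)) p)%N = #|{: K}|.
  by rewrite card_tagged sumnE big_map big_enum; apply: eq_bigr => i _; rewrite card_ord.
apply: (mu_eq_card (M := N)) => [t|[i k] [j l] ij|S [sS pS]].
- have [sN N0 NV] := NP t; split=> //.
  rewrite (cdim _ _ sN N0) coprimeMr rp (module_iso_dim NV).
  by have [/(_ (tagged t))[]] := V_indep (tag t).
- have [/= sNi Ni0 NVi] := NP (inK i k); have [/= sNj Nj0 NVj] := NP (inK j l).
  have Ni0' := module_iso_mact ij Ni0.
  have eij : i = j.
    by apply/rI/(simple_double_support sNj); rewrite -io1.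
  case: j / eij l ij sNj Nj0 NVj Ni0' => l ij _ _ NVj _.
  congr (inK i _); have [_ uV] := V_indep i; apply: uV.
  apply: module_iso_trans (module_iso_sym NVi) _; apply: module_iso_trans NVj.
  exact: corner_module_iso.
have [x Sx] := simple_double_fiber sS.
have px : coprime p #|lorbit x|.
  by move: pS; rewrite (dim_simple_double sS Sx) coprimeMr => /andP[].
have [i /imsetP[g _ ix]] := rC x px.
have Si : mact S (io i 1) != 0.
  apply: contraNneq Sx => S0; apply/eqP/lfunP=> v; rewrite zero_lfunE.
  have -> : e x = dbasis F x g^-1%g * (e (r i) * dbasis F (r i) g).
    by rewrite dbasisM lact1 eqxx scale1r mul1g dbasisM ix lactK eqxx scale1r mulVg.
  by rewrite !mactME -io1 S0 zero_lfunE linear0.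
have /V_compl[k kV] : mu_module p (corner_module (ioM i) S).
  split; first exact: (corner_module_simple (ioM i) (ioC i)).
  by move: pS; rewrite (cdim i S sS Si) coprimeMr => /andP[].
exists (inK i k); have [/= sN N0 NV] := NP (inK i k).
apply: (corner_module_iso_inj (iotaM := ioM i) (ioC i)) sS sN Si _.
exact: module_iso_trans kV (module_iso_sym NV).
Qed.

End DoubleModules.

(** * Orbits of length prime to p *)

Section SylowOrbits.
Variables (p : nat) (gT : finGroupType) (P : {group gT}) (X : lset gT).
Hypotheses (p_pr : prime p) (sylP : (p.-Sylow([set: gT]) P)%g).
Local Open Scope group_scope.
Implicit Types (x y : X) (K : {group gT}).

(** Turns the left action into a right one: on the right, g acts as its inverse
    does on the left. *)
Definition ract x (g : gT) : X := lact g^-1 x.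

Fact ract1 : ract^~ 1 =1 id.
Proof. by move=> x; rewrite /ract invg1 lact1. Qed.

Fact ractM x : act_morph ract x.
Proof. by move=> g h; rewrite /ract invMg lactM. Qed.

Definition lset_action : {action gT &-> X} := TotalAction ract1 ractM.
Notation to := lset_action.

Lemma lset_actionE x g : to x g = lact g^-1 x. Proof. by []. Qed.

Lemma orbit_lactP K x y :
  reflect (exists2 g, g \in K & y = lact g x) (y \in orbit to K x).
Proof.
apply: (iffP orbitP) => [[g Kg <-]|[g Kg ->]]; exists g^-1; rewrite ?groupV //.
by rewrite lset_actionE invgK.
Qed.

Lemma astab1_lactE x g : (g \in 'C[x | to]) = (lact g x == x).
Proof. by rewrite -groupV !inE sub1set inE lset_actionE invgK. Qed.

Lemma lorbitE x : lorbit x = orbit to [set: gT] x.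
Proof.
apply/setP=> y; apply/imsetP/orbit_lactP => [[g _ ->]|[g _ ->]]; by exists g.
Qed.

Definition sylow_fixed : {set X} := 'Fix_to(P).

Lemma sylow_fixedP x : reflect (forall g, g \in P -> lact g x = x) (x \in sylow_fixed).
Proof.
apply: (iffP afixP) => fx g Pg; last by rewrite lset_actionE fx ?groupV.
by rewrite -[g]invgK -lset_actionE fx ?groupV.
Qed.

Lemma sylow_fixed_astab x : (x \in sylow_fixed) = (P \subset 'C[x | to]).
Proof.
apply/sylow_fixedP/subsetP=> [fx g Pg|sP g /sP]; rewrite astab1_lactE ?fx //.
by move/eqP.
Qed.

(** The orbit has |K : K_x| elements, and P lies in K_x. *)
Lemma sylow_fixed_orbit K x :
  P \subset K -> x \in sylow_fixed -> coprime p #|orbit to K x|.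
Proof.
move=> sPK fx; rewrite card_orbit prime_coprime // -p'natE //.
apply: (@pnat_dvd _ #|K : P|); first by rewrite indexgS // subsetI sPK -sylow_fixed_astab.
by apply: pnat_dvd (indexSg sPK (subsetT K)) _; case/and3P: sylP.
Qed.

(** A p-group acting on a set of size prime to p has a fixed point. *)
Lemma orbit_sylow_fixed K x : P \subset K -> coprime p #|orbit to K x| ->
  exists2 y, y \in sylow_fixed & y \in orbit to K x.
Proof.
move=> sPK px; have /pgroup_fix_mod E := pHall_pgroup sylP.
have /E{}E : [acts P, on orbit to K x | to].
  by apply: subset_trans sPK _; rewrite acts_orbit ?subsetT.
have : #|'Fix_(orbit to K x | to)(P)| != 0%N.
  apply: contraTneq px => F0; rewrite prime_coprime // negbK /dvdn E F0.
  by rewrite mod0n.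
by rewrite -lt0n => /card_gt0P[y]; rewrite inE => /andP[oy fy]; exists y.
Qed.

(** Burnside's fusion argument: if x and y = gx are fixed by P, then P and its
    conjugate by g are Sylow subgroups of the stabilizer of y. *)
Lemma sylow_fixed_fusion x y : x \in sylow_fixed -> y \in sylow_fixed ->
  y \in lorbit x -> y \in orbit to 'N(P) x.
Proof.
move=> fx fy /imsetP[g _ yE].
have sylC (Q : {group gT}) : Q \subset 'C[y | to] -> #|Q| = #|P| ->
    p.-Sylow('C[y | to]) Q.
  move=> sQ cQ; rewrite pHallE sQ cQ /=.
  have sPy : P \subset 'C[y | to] by rewrite -sylow_fixed_astab.
  have /card_Hall-> : p.-Sylow('C[y | to]) P.
    by apply: pHall_subl sPy (subsetT _) sylP.
  by [].
have sylPy : p.-Sylow('C[y | to]) P by rewrite sylC -?sylow_fixed_astab.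
have sylPg : p.-Sylow('C[y | to]) (P :^ g^-1).
  apply: sylC; last by rewrite cardJg.
  apply/subsetP=> h; rewrite mem_conjg invgK => Ph.
  rewrite astab1_lactE yE -lactM; have /sylow_fixedP/(_ _ Ph) := fx.
  by move/(congr1 (lact g)); rewrite -!lactM /conjg !mulgA mulgV mul1g => ->.
have [h hy defP] := Sylow_trans sylPg sylPy.
apply/orbit_lactP; exists (h^-1 * g); last first.
  have : h^-1 \in 'C[y | to] by rewrite groupV.
  by rewrite astab1_lactE lactM -yE => /eqP.
by rewrite -groupV invMg invgK; apply/normP; rewrite conjsgM -defP.
Qed.

Fact norm_acts_sylow_fixed : [acts 'N(P), on sylow_fixed | to].
Proof. by apply: acts_fix_norm. Qed.

Definition sylow_reps : {set X} := orbit_transversal to 'N(P) sylow_fixed.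
Definition sylow_rep := {x : X | x \in sylow_reps}.
HB.instance Definition _ := SubFinite.on sylow_rep.
Implicit Types i : sylow_rep.

Lemma sylow_rep_fixed i : val i \in sylow_fixed.
Proof.
have [_ /subsetP sT _ _] := orbit_transversalP norm_acts_sylow_fixed.
exact/sT/valP.
Qed.

Lemma sylow_rep_inj i k : val k \in orbit to 'N(P) (val i) -> i = k.
Proof.
have [_ _ uT _] := orbit_transversalP norm_acts_sylow_fixed.
by rewrite uT ?(valP i) ?(valP k) // => /eqP/val_inj.
Qed.

Lemma sylow_rep_complete K x : P \subset K -> 'N(P) \subset K ->
  coprime p #|orbit to K x| -> exists i : sylow_rep, val i \in orbit to K x.
Proof.
move=> sPK sNK /(orbit_sylow_fixed sPK)[y fy oy].
have [_ _ _ cT] := orbit_transversalP norm_acts_sylow_fixed.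
have [n Nn Tn] := cT y fy; exists (exist (fun z => z \in sylow_reps) _ Tn).
by have /orbit_eqP <- := oy; apply: (mem_orbit to y (subsetP sNK n Nn)).
Qed.

Definition sylow_stab i : {group gT} := 'C[val i | to]%G.
Definition stab_sylow i : {group subg_of (sylow_stab i)} :=
  (subg (sylow_stab i) @* P)%G.

Lemma sub_sylow_stab i : P \subset sylow_stab i.
Proof. by rewrite -sylow_fixed_astab sylow_rep_fixed. Qed.

Lemma stab_sylow_Sylow i : p.-Sylow([set: subg_of (sylow_stab i)]) (stab_sylow i).
Proof.
have <- := im_subg (sylow_stab i); rewrite morphim_pHall ?sub_sylow_stab //.
exact: pHall_subl (sub_sylow_stab i) (subsetT _) sylP.
Qed.

(** N_{G_x}(P) is the intersection of N and G_x. *)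
Lemma norm_stab_sylow i (h : subg_of (sylow_stab i)) :
  (h \in 'N(stab_sylow i)) = (sgval h \in 'N(P)).
Proof.
have injv := injm_sgval (sylow_stab i).
have := injm_norms injv (subsetT [set h]) (subsetT (stab_sylow i)).
rewrite morphim_set1 ?in_setT // !sub1set => <-.
by rewrite /= subgmK ?sub_sylow_stab.
Qed.

End SylowOrbits.

(** * The counting formulas *)

Section SylowCount.
Variables (F : fieldType) (p : nat) (gT : finGroupType) (P : {group gT}) (X : lset gT).
Hypotheses (p_pr : prime p) (sylP : (p.-Sylow([set: gT]) P)%g).
Local Open Scope group_scope.
Notation N := 'N(P)%G.

(** The representatives are pairwise inequivalent under N only by construction;
    fusion makes them inequivalent under G. *)
Lemma mu_double_sylow :
  mu (double_alg F X) p =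
  (\sum_(i : sylow_rep P X) mu (group_alg F (subg_of (sylow_stab i))) p)%N.
Proof.
apply: (@mu_double_orbits F gT X p _ (fun i : sylow_rep P X => val i)
  (fun i => subg_of (sylow_stab i)) (fun i => @sgval _ _)).
- by [].
- by move=> i; exact: subg_inj.
- move=> i g; rewrite -astab1_lactE; apply/idP/codomP => [Cg|[h ->]].
    by exists (subg _ g); rewrite [sgval _]subgK.
  exact: subgP.
- by move=> i; rewrite lorbitE (sylow_fixed_orbit p_pr sylP) ?subsetT ?sylow_rep_fixed.
- move=> i j ij; apply: sylow_rep_inj.
  exact: (sylow_fixed_fusion sylP (sylow_rep_fixed i) (sylow_rep_fixed j) ij).
move=> x; rewrite lorbitE => /(sylow_rep_complete p_pr sylP).
by case=> [||i ri]; rewrite ?subsetT //; exists i.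
Qed.

(** The inclusion of N_{G_x}(P) in N. *)
Definition stab_norm_incl (i : sylow_rep P X) (h : subg_of 'N(stab_sylow i)) :
  subg_of N := subg N (sgval (sgval h)).

Lemma stab_norm_inclE i (h : subg_of 'N(stab_sylow i)) :
  sgval (stab_norm_incl h) = sgval (sgval h).
Proof. by rewrite [LHS]subgK // -norm_stab_sylow ?subgP. Qed.

Lemma stab_norm_inclM i (h k : subg_of 'N(stab_sylow i)) :
  stab_norm_incl (h * k) = stab_norm_incl h * stab_norm_incl k.
Proof. by apply: val_inj; rewrite /= !stab_norm_inclE. Qed.

Lemma stab_norm_incl_inj i : injective (@stab_norm_incl i).
Proof.
by move=> h k /(congr1 sgval); rewrite !stab_norm_inclE => /subg_inj/subg_inj.
Qed.

Lemma stab_norm_incl_codom i (n : subg_of N) :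
  (n \in codom (@stab_norm_incl i)) = (lact (sgval n) (val i) == val i).
Proof.
rewrite -astab1_lactE; apply/codomP/idP => [[h ->]|Cn].
  by rewrite stab_norm_inclE subgP.
have nE : sgval (subg (sylow_stab i) (sgval n)) = sgval n by rewrite [LHS]subgK.
have nN : subg (sylow_stab i) (sgval n) \in 'N(stab_sylow i).
  by rewrite norm_stab_sylow nE subgP.
exists (subg _ (subg _ (sgval n))); apply: val_inj.
by rewrite /= stab_norm_inclE [sgval (subg _ (subg _ _))]subgK.
Qed.

(** The set Y is an N-stable part of X that contains the P-fixed points, hence all
    N-orbits of length prime to p.  It will be X itself, or N inside G
    under conjugation. *)
Lemma mu_double_norm (Y : lset (subg_of N)) (j : Y -> X) :
    injective j -> (forall n y, j (lact n y) = lact (sgval n) (j y)) ->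
    (forall x, x \in sylow_fixed P X -> exists y, j y = x) ->
  mu (double_alg F Y) p =
  (\sum_(i : sylow_rep P X) mu (group_alg F (subg_of 'N(stab_sylow i))) p)%N.
Proof.
move=> j_inj jM j_fix.
have j_orbit y : j @: lorbit y = orbit (lset_action X) N (j y).
  apply/setP=> x; apply/imsetP/orbit_lactP => [[_ /imsetP[n _ ->] ->]|[n Nn ->]].
    by exists (sgval n); rewrite ?subgP.
  exists (lact (subg N n) y); first by apply/imsetP; exists (subg N n).
  by rewrite jM [sgval _]subgK.
have j_lorbit y z : (z \in lorbit y) = (j z \in orbit (lset_action X) N (j y)).
  by rewrite -j_orbit mem_imset.
have j_card y : #|lorbit y| = #|orbit (lset_action X) N (j y)|.
  by rewrite -j_orbit card_imset.
have /boolp.choice[r rE] : forall i : sylow_rep P X, exists y, j y = val i.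
  by move=> i; exact/j_fix/sylow_rep_fixed.
apply: (@mu_double_orbits F _ Y p _ r (fun i => subg_of 'N(stab_sylow i))
  (@stab_norm_incl)).
- exact: stab_norm_inclM.
- exact: stab_norm_incl_inj.
- by move=> i n; rewrite stab_norm_incl_codom -rE -jM (inj_eq j_inj).
- move=> i; rewrite j_card rE.
  by rewrite (sylow_fixed_orbit p_pr sylP) ?normG ?sylow_rep_fixed.
- by move=> i k; rewrite j_lorbit !rE => /sylow_rep_inj.
move=> y; rewrite j_card => /(sylow_rep_complete p_pr sylP)[].
- exact: normG.
- exact: subxx.
by move=> i ri; exists i; rewrite j_lorbit rE.
Qed.

Lemma mu_double_restr :
  mu (double_alg F (lset_restr N X)) p =
  (\sum_(i : sylow_rep P X) mu (group_alg F (subg_of 'N(stab_sylow i))) p)%N.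
Proof. by apply: (@mu_double_norm (lset_restr N X) id) => // x _; exists x. Qed.

Lemma MC1_double_sylow : MC1 F p ->
  mu (double_alg F X) p =
  (\sum_(i : sylow_rep P X) mu (group_alg F (subg_of 'N(stab_sylow i))) p)%N.
Proof.
move=> mc1; rewrite mu_double_sylow; apply: eq_bigr => i _.
exact/mc1/stab_sylow_Sylow.
Qed.

End SylowCount.

Section Doubles.
Variables (F : fieldType) (p : nat).
Hypothesis p_pr : prime p.
Local Open Scope group_scope.

Lemma conj_sylow_fixed (gT : finGroupType) (P : {group gT}) x :
  (x \in sylow_fixed P (lset_conj gT)) = (x \in 'C(P)).
Proof.
apply/sylow_fixedP/centP => fx g Pg.
  by rewrite /commute -{1}(fx g Pg) /= /lconj mulgKV.
by rewrite /= /lconj -[g * x](fx g Pg) mulgK.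
Qed.

(** Elements fixed by P under conjugation centralize P, so they lie in N(P). *)
Lemma mu_quantum_double_norm (gT : finGroupType) (P : {group gT}) :
    p.-Sylow([set: gT]) P ->
  mu (quantum_double F (subg_of 'N(P))) p =
  (\sum_(i : sylow_rep P (lset_conj gT)) mu (group_alg F (subg_of 'N(stab_sylow i))) p)%N.
Proof.
move=> sylP; apply: (@mu_double_norm F p gT P (lset_conj gT) p_pr sylP
  (lset_conj (subg_of 'N(P))) (@sgval _ _)) => //.
  exact: subg_inj.
move=> x; rewrite conj_sylow_fixed => /(subsetP (cent_sub P)) Nx.
by exists (subg _ x); rewrite [sgval _]subgK.
Qed.

(** The only point has stabilizer G, for which any isomorphic group will do. *)
Lemma mu_double_point (gT hT : finGroupType) (X : lset gT) (f : hT -> gT) :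
    #|X| = 1%N -> {morph f : h k / h * k} -> bijective f ->
  mu (double_alg F X) p = mu (group_alg F hT) p.
Proof.
move=> X1 fM [g fK gK]; have [x xE] : exists x : X, forall y, y = x.
  have /eqP/fintype1P[x xE] := X1; exists x => y; exact: xE.
have orb (y z : X) : y \in lorbit z by rewrite (xE y) -(xE z) lorbit_refl.
rewrite (@mu_double_orbits F gT X p unit (fun=> x) (fun=> hT) (fun=> f)).
- by rewrite big_const cardT enumT unlock /= addn0.
- by [].
- by move=> _; exact: can_inj fK.
- by move=> _ k; rewrite [lact _ _]xE eqxx; apply/esym/codomP; exists (g k); rewrite gK.
- move=> _; have -> : #|lorbit x| = 1%N; last by rewrite coprimen1.
  apply/eqP/cards1P; exists x; apply/setP=> y; rewrite orb inE.
  by rewrite (xE y) eqxx.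
- by move=> [] [].
- by move=> y _; exists tt.
Qed.

Fact unit_gt0 : (0 < #|{: unit}|)%N. Proof. by rewrite card_unit. Qed.

Definition lset_point (gT : finGroupType) : lset gT :=
  @LSet gT unit (fun _ x => x) (fun _ => erefl) (fun _ _ _ => erefl) unit_gt0.

(** Both group algebras are the algebra D_X of a point. *)
Lemma mu_group_alg_iso (gT hT : finGroupType) (f : hT -> gT) :
    {morph f : h k / h * k} -> bijective f ->
  mu (group_alg F hT) p = mu (group_alg F gT) p.
Proof.
move=> fM fB; rewrite -(@mu_double_point _ _ (lset_point gT) f) ?card_unit //.
by apply: (@mu_double_point _ _ (lset_point gT) id); rewrite ?card_unit //; exists id.
Qed.

Lemma MCT_MC1 : MCT F p -> MC1 F p.
Proof.
move=> mct gT P sylP.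
have tr : ltransitive (lset_point gT) by move=> [] []; exists 1.
have := mct gT P sylP _ tr; rewrite /M_pair.
rewrite (@mu_double_point gT gT _ id) ?card_unit //; last by exists id.
by rewrite (@mu_double_point (subg_of 'N(P)) _ _ id) ?card_unit //; exists id.
Qed.

Lemma MC1_MCD : MC1 F p -> MCD F p.
Proof.
move=> mc1 gT P sylP; rewrite /M_pair mu_quantum_double_norm //.
exact: MC1_double_sylow.
Qed.

Lemma MC1_MCX : MC1 F p -> MCX F p.
Proof.
move=> mc1 gT P sylP X; rewrite /M_pair mu_double_restr //.
exact: MC1_double_sylow.
Qed.

(** Induction on the order of G.  In the formulas for D(G) and D(N) the terms of
    noncentral elements agree by induction, each central one contributes
    mu(C[G]) and mu(C[N]) respectively, and 1 is central. *)
Lemma MCD_MC1 : MCD F p -> MC1 F p.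
Proof.
move=> mcd gT; have [n le_n] := ubnP #|gT|.
elim: n => // n IHn in gT le_n *; move=> P sylP; rewrite /M_pair.
pose X := lset_conj gT.
pose a (i : sylow_rep P X) := mu (group_alg F (subg_of (sylow_stab i))) p.
pose b (i : sylow_rep P X) := mu (group_alg F (subg_of 'N(stab_sylow i))) p.
have ab : (\sum_i a i = \sum_i b i)%N.
  rewrite -(mu_double_sylow F X p_pr sylP) -(mu_quantum_double_norm sylP).
  exact: mcd.
pose central (i : sylow_rep P X) := sylow_stab i == [set: gT] :> {set gT}.
have a_c i : central i -> a i = mu (group_alg F gT) p.
  move=> /eqP Ci; apply: (mu_group_alg_iso (f := sgval)) => //.
  exists (subg (sylow_stab i)) => [|g]; first exact: sgvalK.
  by rewrite [LHS]subgK ?Ci ?inE.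
have b_c i : central i -> b i = mu (group_alg F (subg_of 'N(P))) p.
  move=> /eqP Ci; apply: (mu_group_alg_iso (f := @stab_norm_incl _ P X i)).
    exact: stab_norm_inclM.
  apply: inj_card_bij; first exact: stab_norm_incl_inj.
  rewrite -(card_codom (@stab_norm_incl_inj _ P X i)); apply: subset_leq_card.
  apply/subsetP=> m _; rewrite stab_norm_incl_codom -astab1_lactE.
  by rewrite -[sgval m \in _]/(sgval m \in sylow_stab i) Ci inE.
have ab_nc i : ~~ central i -> a i = b i.
  move=> nCi; apply: IHn (stab_sylow_Sylow sylP i).
  have : (#|sylow_stab i| < #|[set: gT]|)%N by rewrite proper_card // properT.
  rewrite -(im_sgval (sylow_stab i)) card_injm ?injm_sgval // !cardsT => lt_i.
  by rewrite -ltnS; apply: leq_trans le_n.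
have [i1 c1] : exists i, central i.
  have f1 : 1 \in sylow_fixed P X by rewrite conj_sylow_fixed group1.
  have p1 := sylow_fixed_orbit p_pr sylP (normG P) f1.
  have [i /orbit_lactP[g _ iE]] :=
    sylow_rep_complete p_pr sylP (normG P) (subxx _) p1.
  exists i; apply/eqP/setP=> h; rewrite [RHS]inE [LHS]astab1_lactE iE.
  by rewrite /= /lconj !mulg1 !mulgV mulg1 mulgV eqxx.
move: ab; rewrite (bigID central) [RHS](bigID central) /=.
rewrite (eq_bigr _ ab_nc) => /addIn.
rewrite (eq_bigr _ a_c) [RHS](eq_bigr _ b_c) !sum_nat_const => /eqP.
by rewrite eqn_pmul2l => [/eqP|]; last by apply/card_gt0P; exists i1.
Qed.

End Doubles.

Theorem theorem2p5 (R : realType) (p : nat) (hp : prime p) :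
  [<-> MC1 R[i] p; MCD R[i] p; MCX R[i] p; MCT R[i] p].
Proof.
tfae=> [|mcd|mcx gT P sylP X _|].
- exact: MC1_MCD.
- exact/MC1_MCX/MCD_MC1.
- exact: mcx.
- exact: MCT_MC1.
Qed.
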